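(* Let $k$ be a field of characteristic $0$ and let $\Theta$ be an arbitrary subvariety of the variety of all anticommutative linear algebras over $k$ that is defined by identities with coefficients from $\mathbb{Z}$, and assume that $\Theta$ is neither the variety defined by the identity $x=0$ nor the variety defined by the identity $x_1x_2=0$. Let $\mathfrak{A}$ be the group of all automorphisms of the category $\Theta^0$ of finitely generated free algebras of $\Theta$, and let $\mathfrak{Y}$ be the normal subgroup of all inner automorphisms. Then $$\mathfrak{A}/\mathfrak{Y}\;\cong\; \mathrm{Aut}\,k ,$$ where $\mathrm{Aut}\,k$ is the group of all field automorphisms of $k$.
   Context: A linear algebra over $k$ is a $k$-vector space with a $k$-bilinear multiplication (not assumed associative, commutative or unital). It is regarded as a one-sorted universal algebra with operations $0$, $+$, $\cdot$, and one unary operation $h\mapsto\lambda h$ for each $\lambda\in k$; homomorphisms are $k$-linear multiplicative maps. The variety of all anticommutative algebras is defined by the identity $x_1x_2=-x_2x_1$. An identity with coefficients from $\mathbb{Z}$ is one of the form $\sum_i\lambda_iu_i=0$ with $\lambda_i\in\mathbb{Z}$ and $u_i$ nonassociative monomials (with coefficient $1$) in the variables. Fix a countable set $X_0=\{x_1,x_2,\ldots\}$. The category $\Theta^0$ has as objects the free algebras $F(X)$ of $\Theta$ generated by finite subsets $X\subset X_0$, and as morphisms all homomorphisms between them. An automorphism of a category $\mathfrak{K}$ is an invertible functor $\mathfrak{K}\to\mathfrak{K}$; an automorphism $\Upsilon$ is inner if it is isomorphic as a functor to the identity functor, i.e. for each object $A$ there is an isomorphism $s_A:A\to\Upsilon(A)$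 with $\Upsilon(\psi)s_A=s_B\psi$ for every morphism $\psi:A\to B$. *)

(* Defs.v *)
From HB Require Import structures.
From mathcomp Require Import all_boot all_order all_algebra.
From mathcomp Require Import finmap.
From mathcomp Require Import boolp classical_sets.

Set Implicit Arguments.
Unset Strict Implicit.
Unset Printing Implicit Defensive.

Import GRing.Theory.
Local Open Scope ring_scope.

Section Units.
Local Open Scope group_scope.
Variable M : monoidType.

(* Invertible elements; uinv is determined by uval, see munit_inj. *)
Record munit := MUnit {
  uval :> M;
  uinv : M;
  umulV : uval * uinv = 1;
  uVmul : uinv * uval = 1
}.

Lemma munit_inj : injective uval.
Proof.
move=> [a b ab ba] [a' c ac ca] /= eaa'.
rewrite -{}eaa' {a'} in ac ca *.
have ebc : b = c by rewrite -[b]mulg1 -ac mulgA ba mul1g.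
rewrite -{}ebc in ac ca *.
by congr MUnit; exact: Prop_irrelevance.
Qed.

HB.instance Definition _ := gen_eqMixin munit.
HB.instance Definition _ := gen_choiceMixin munit.

Definition munit1 := MUnit (mul1g (1 : M)) (mul1g (1 : M)).

Lemma munit_mulV (u v : munit) : (uval u * uval v) * (uinv v * uinv u) = 1.
Proof. by rewrite mulgA -[_ * uinv v]mulgA umulV mulg1 umulV. Qed.

Lemma munit_Vmul (u v : munit) : (uinv v * uinv u) * (uval u * uval v) = 1.
Proof. by rewrite mulgA -[_ * uval u]mulgA uVmul mulg1 uVmul. Qed.

Definition munit_mul u v := MUnit (munit_mulV u v) (munit_Vmul u v).
Definition munit_inv (u : munit) := MUnit (uVmul u) (umulV u).

Lemma munit_mulA : associative munit_mul.
Proof. by move=> u v w; apply: munit_inj; rewrite /= mulgA. Qed.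
Lemma munit_mul1 : left_id munit1 munit_mul.
Proof. by move=> u; apply: munit_inj; rewrite /= mul1g. Qed.
Lemma munit_1mul : right_id munit1 munit_mul.
Proof. by move=> u; apply: munit_inj; rewrite /= mulg1. Qed.
Lemma munit_mulVl : left_inverse munit1 munit_inv munit_mul.
Proof. by move=> u; apply: munit_inj; rewrite /= uVmul. Qed.
Lemma munit_mulVr : right_inverse munit1 munit_inv munit_mul.
Proof. by move=> u; apply: munit_inj; rewrite /= umulV. Qed.

HB.instance Definition _ := isGroup.Build munit
  munit_mulA munit_mul1 munit_1mul munit_mulVl munit_mulVr.

End Units.

Record normal_subgroup (G : groupType) := NormalSubgroup {
  ns_pred :> {pred G};
  ns_group : group_closed ns_pred;
  ns_normal : forall x y : G, x \in ns_pred -> (x ^ y)%g \in ns_pred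
}.

Section Quotient.
Local Open Scope group_scope.
Local Open Scope quotient_scope.
Variables (G : groupType) (N : normal_subgroup G).

Definition coset_rel (x y : G) : bool := (x^-1 * y) \in N.

Lemma coset_rel_refl : reflexive coset_rel.
Proof. by move=> x; rewrite /coset_rel mulVg; case: (ns_group N). Qed.

Lemma coset_rel_sym : symmetric coset_rel.
Proof.
have half x y : coset_rel x y -> coset_rel y x.
  by move=> /(group_closedV (ns_group N)); rewrite invgM invgK.
by move=> x y; apply/idP/idP; exact: half.
Qed.

Lemma coset_rel_trans : transitive coset_rel.
Proof.
move=> y x z xy yz; have := group_closedM (ns_group N) xy yz.
by rewrite mulgA -[_ * y * _]mulgA mulgV mulg1.
Qed.

Canonical coset_equiv :=
  EquivRel coset_rel coset_rel_refl coset_rel_sym coset_rel_trans.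

Definition quotg := {eq_quot coset_equiv}.

HB.instance Definition _ := EqQuotient.on quotg.
HB.instance Definition _ := Choice.on quotg.

Definition quotg_pi (x : G) : quotg := \pi_quotg x.

Lemma quotg_eqP x y : quotg_pi x = quotg_pi y <-> coset_rel x y.
Proof. by split => [/eqmodP|h] //; apply/eqmodP. Qed.

Definition quotg_one := quotg_pi 1.
Definition quotg_mul (a b : quotg) := quotg_pi (repr a * repr b).
Definition quotg_inv (a : quotg) := quotg_pi (repr a)^-1.

Lemma quotg_piK a : quotg_pi (repr a) = a.
Proof. exact: reprK. Qed.

Lemma quotg_piM x y : quotg_mul (quotg_pi x) (quotg_pi y) = quotg_pi (x * y).
Proof.
apply/quotg_eqP; rewrite coset_rel_sym.
set x' := repr (quotg_pi x); set y' := repr (quotg_pi y).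
have xx' : coset_rel x x' by apply/quotg_eqP; rewrite quotg_piK.
have yy' : coset_rel y y' by apply/quotg_eqP; rewrite quotg_piK.
have := group_closedM (ns_group N) (ns_normal y xx') yy'.
rewrite /coset_rel conjgE invgM !mulgA.
by rewrite -[_ * y * y^-1]mulgA mulgV mulg1.
Qed.

Lemma quotg_piV x : quotg_inv (quotg_pi x) = quotg_pi x^-1.
Proof.
apply/quotg_eqP; set x' := repr (quotg_pi x).
have xx' : coset_rel x' x by apply/quotg_eqP; rewrite quotg_piK.
have := group_closedV (ns_group N) (ns_normal x^-1 xx').
by rewrite /coset_rel conjgE !invgM !invgK !mulgA mulgV mul1g.
Qed.

Lemma quotg_mulA : associative quotg_mul.
Proof.
move=> a b c; rewrite -(quotg_piK a) -(quotg_piK b) -(quotg_piK c).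
by rewrite !quotg_piM mulgA.
Qed.
Lemma quotg_mul1 : left_id quotg_one quotg_mul.
Proof. by move=> a; rewrite -(quotg_piK a) quotg_piM mul1g. Qed.
Lemma quotg_1mul : right_id quotg_one quotg_mul.
Proof. by move=> a; rewrite -(quotg_piK a) quotg_piM mulg1. Qed.
Lemma quotg_mulVl : left_inverse quotg_one quotg_inv quotg_mul.
Proof. by move=> a; rewrite -(quotg_piK a) quotg_piV quotg_piM mulVg. Qed.
Lemma quotg_mulVr : right_inverse quotg_one quotg_inv quotg_mul.
Proof. by move=> a; rewrite -(quotg_piK a) quotg_piV quotg_piM mulgV. Qed.

HB.instance Definition _ := isGroup.Build quotg
  quotg_mulA quotg_mul1 quotg_1mul quotg_mulVl quotg_mulVr.

End Quotient.

Definition isomorphic_groups (G H : groupType) : Prop :=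
  exists f : {multiplicative G -> H}, bijective f.

Section FieldAut.
Variable k : fieldType.

Definition field_end := {rmorphism k -> k}.

HB.instance Definition _ := gen_eqMixin field_end.
HB.instance Definition _ := gen_choiceMixin field_end.

Lemma field_end_ext (f g : field_end) :
  (f : k -> k) =1 (g : k -> k) -> f = g.
Proof.
case: f g => [f [[f1] [f2]]] [g [[g1] [g2]]] /= /funext efg.
rewrite -{}efg {g} in g1 g2 *.
by rewrite (Prop_irrelevance g1 f1) (Prop_irrelevance g2 f2).
Qed.

Definition field_end_mul (f g : field_end) : field_end :=
  (f : {rmorphism k -> k}) \o (g : {rmorphism k -> k}).
Definition field_end_one : field_end := idfun.

Lemma field_end_mulA : associative field_end_mul.
Proof. by move=> f g h; exact: field_end_ext. Qed.
Lemma field_end_mul1 : left_id field_end_one field_end_mul.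
Proof. by move=> f; exact: field_end_ext. Qed.
Lemma field_end_1mul : right_id field_end_one field_end_mul.
Proof. by move=> f; exact: field_end_ext. Qed.

HB.instance Definition _ := isMonoid.Build field_end
  field_end_mulA field_end_mul1 field_end_1mul.

Definition field_aut := munit field_end.
HB.instance Definition _ := Group.on field_aut.

End FieldAut.

Record category := Category {
  obj :> Type;
  hom : obj -> obj -> Type;
  idm : forall a, hom a a;
  comp : forall a b c, hom b c -> hom a b -> hom a c;
  comp_idl : forall a b (f : hom a b), comp (idm b) f = f;
  comp_idr : forall a b (f : hom a b), comp f (idm a) = f;
  compA : forall a b c d (f : hom c d) (g : hom b c) (h : hom a b),
    comp f (comp g h) = comp (comp f g) h
}.
Arguments hom {_} _ _.
Arguments idm {_} _.
Arguments comp {_ _ _ _} _ _.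

Definition is_iso (C : category) (a b : C) (f : hom a b) : Prop :=
  exists g : hom b a, comp g f = idm a /\ comp f g = idm b.

Section Endofunctors.
Variable C : category.

Record endofunctor := Endofunctor {
  fobj :> C -> C;
  fmap : forall a b : C, hom a b -> hom (fobj a) (fobj b);
  fmap_id : forall a, fmap (idm a) = idm (fobj a);
  fmap_comp : forall a b c (f : hom b c) (g : hom a b),
    fmap (comp f g) = comp (fmap f) (fmap g)
}.

Lemma fcomp_id (F G : endofunctor) a :
  fmap F (fmap G (idm a)) = idm (F (G a)).
Proof. by rewrite !fmap_id. Qed.

Lemma fcomp_comp (F G : endofunctor) a b c (f : hom b c) (g : hom a b) :
  fmap F (fmap G (comp f g)) =
  comp (fmap F (fmap G f)) (fmap F (fmap G g)).
Proof. by rewrite !fmap_comp. Qed.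

Definition fcomp (F G : endofunctor) : endofunctor :=
  @Endofunctor (fun a => F (G a)) (fun a b f => fmap F (fmap G f))
    (fcomp_id F G) (@fcomp_comp F G).

Definition fid : endofunctor :=
  @Endofunctor id (fun _ _ f => f) (fun=> erefl) (fun _ _ _ _ _ => erefl).

HB.instance Definition _ := gen_eqMixin endofunctor.
HB.instance Definition _ := gen_choiceMixin endofunctor.

Lemma fcompA : associative fcomp.
Proof. by move=> F G H; congr Endofunctor; exact: Prop_irrelevance. Qed.
Lemma fcomp1 : left_id fid fcomp.
Proof. by case=> f h i j; congr Endofunctor; exact: Prop_irrelevance. Qed.
Lemma f1comp : right_id fid fcomp.
Proof. by case=> f h i j; congr Endofunctor; exact: Prop_irrelevance. Qed.

HB.instance Definition _ := isMonoid.Build endofunctor fcompA fcomp1 f1comp.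

Definition isomorphic_functors (F G : endofunctor) : Prop :=
  exists s : forall a : C, hom (F a) (G a),
    (forall a, is_iso (s a)) /\
    (forall a b (f : hom a b), comp (fmap G f) (s a) = comp (s b) (fmap F f)).

Lemma isofun_refl F : isomorphic_functors F F.
Proof.
exists (fun a => idm (F a)); split=> [a|a b f].
  by exists (idm _); rewrite comp_idl.
by rewrite comp_idl comp_idr.
Qed.

Lemma isofun_sym F G : isomorphic_functors F G -> isomorphic_functors G F.
Proof.
case=> s [iso_s nat_s].
have inv_s a : {g : hom (G a) (F a) |
    comp g (s a) = idm _ /\ comp (s a) g = idm _} by apply: cid; exact: iso_s.
exists (fun a => sval (inv_s a)); split=> [a|a b f].
  by exists (s a); case: (svalP (inv_s a)).
have [ts_b _] := svalP (inv_s b); have [_ st_a] := svalP (inv_s a).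
move: (sval (inv_s a)) (sval (inv_s b)) ts_b st_a => ta tb ts_b st_a.
rewrite -[comp tb _]comp_idr -st_a !compA -[comp (comp tb _) (s a)]compA nat_s.
by rewrite compA ts_b comp_idl.
Qed.

Lemma isofun_trans F G H : isomorphic_functors F G ->
  isomorphic_functors G H -> isomorphic_functors F H.
Proof.
case=> s [iso_s nat_s] [t [iso_t nat_t]].
exists (fun a => comp (t a) (s a)); split=> [a|a b f].
  have [s' [s's ss']] := iso_s a; have [t' [t't tt']] := iso_t a.
  exists (comp s' t'); split.
    by rewrite compA -[comp (comp s' t') _]compA t't comp_idr.
  by rewrite compA -[comp (comp (t a) _) _]compA ss' comp_idr.
by rewrite compA nat_t -compA nat_s compA.
Qed.

Lemma isofun_compl F G H :
  isomorphic_functors G H -> isomorphic_functors (fcomp F G) (fcomp F H).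
Proof.
case=> s [iso_s nat_s]; exists (fun a => fmap F (s a)); split=> [a|a b f].
  have [s' [s's ss']] := iso_s a.
  by exists (fmap F s'); rewrite /= -!fmap_comp s's ss' !fmap_id.
by rewrite /= -!fmap_comp nat_s.
Qed.

Lemma isofun_compr F G H :
  isomorphic_functors G H -> isomorphic_functors (fcomp G F) (fcomp H F).
Proof.
by case=> s [iso_s nat_s]; exists (fun a => s (F a)); split=> *;
  [exact: iso_s | exact: nat_s].
Qed.

Definition cat_aut := munit endofunctor.
HB.instance Definition _ := Group.on cat_aut.

Definition is_inner (U : cat_aut) : Prop := isomorphic_functors fid (uval U).

Definition inner_pred : {pred cat_aut} := fun U => `[< is_inner U >].

Lemma inner_group_closed : group_closed inner_pred.
Proof.
split=> [|U V]; first by apply/asboolP; exact: isofun_refl.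
move=> /asboolP iU /asboolP iV; apply/asboolP.
apply: (isofun_trans iU).
have : isomorphic_functors (fcomp (uval U) (fcomp (uval V) (uinv V)))
                           (fcomp (uval U) (fcomp fid (uinv V))).
  by apply: isofun_compl; apply: isofun_compr; exact: isofun_sym.
have -> : fcomp (uval V) (uinv V) = fid := umulV V.
by rewrite fcomp1 f1comp.
Qed.

Lemma inner_normal (U V : cat_aut) :
  U \in inner_pred -> (U ^ V)%g \in inner_pred.
Proof.
move=> /asboolP iU; apply/asboolP.
have : isomorphic_functors (fcomp (uinv V) (fcomp fid (uval V)))
                           (fcomp (uinv V) (fcomp (uval U) (uval V))).
  by apply: isofun_compl; apply: isofun_compr.
by rewrite fcomp1 (uVmul V : fcomp (uinv V) (uval V) = fid).
Qed.

Definition inner_auts : normal_subgroup cat_aut :=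
  NormalSubgroup inner_group_closed inner_normal.

End Endofunctors.

Record linalg (k : fieldType) := LinAlg {
  linalg_sort :> lmodType k;
  amul : {bilinear linalg_sort -> linalg_sort -> linalg_sort}
}.
Arguments amul {k l} : rename.

Section Algebras.
Variable k : fieldType.
Implicit Types A B C : linalg k.

Record alg_hom A B := AlgHom {
  alg_fun :> {linear A -> B};
  alg_homM : forall x y, alg_fun (amul x y) = amul (alg_fun x) (alg_fun y)
}.

Lemma linear_ext A B (f g : {linear A -> B}) :
  (f : A -> B) =1 (g : A -> B) -> f = g.
Proof.
case: f g => [f [[f1] [f2]]] [g [[g1] [g2]]] /= /funext efg.
rewrite -{}efg {g} in g1 g2 *.
by rewrite (Prop_irrelevance g1 f1) (Prop_irrelevance g2 f2).
Qed.

Lemma alg_hom_ext A B (f g : alg_hom A B) :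
  (f : A -> B) =1 (g : A -> B) -> f = g.
Proof.
case: f g => [f fM] [g gM] /= /linear_ext efg.
by rewrite -{}efg in gM *; congr AlgHom; exact: Prop_irrelevance.
Qed.

Definition alg_id A : alg_hom A A := @AlgHom A A idfun (fun _ _ => erefl).

Lemma alg_compM A B C (f : alg_hom B C) (g : alg_hom A B) x y :
  (f \o g) (amul x y) = amul ((f \o g) x) ((f \o g) y).
Proof. by rewrite /= !alg_homM. Qed.

Definition alg_comp A B C (f : alg_hom B C) (g : alg_hom A B) : alg_hom A C :=
  @AlgHom A C (f \o g) (alg_compM f g).

Lemma alg_comp_idl A B (f : alg_hom A B) : alg_comp (alg_id B) f = f.
Proof. exact: alg_hom_ext. Qed.
Lemma alg_comp_idr A B (f : alg_hom A B) : alg_comp f (alg_id A) = f.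
Proof. exact: alg_hom_ext. Qed.
Lemma alg_compA A B C D (f : alg_hom C D) (g : alg_hom B C) (h : alg_hom A B) :
  alg_comp f (alg_comp g h) = alg_comp (alg_comp f g) h.
Proof. exact: alg_hom_ext. Qed.

End Algebras.

Inductive monomial := Xvar of nat | Xmul of monomial & monomial.

(* [:: (l_1, u_1); ...; (l_r, u_r)] stands for l_1 u_1 + ... + l_r u_r = 0. *)
Definition zidentity := seq (int * monomial).

Section Varieties.
Variable k : fieldType.
Implicit Type A : linalg k.

Fixpoint meval A (e : nat -> A) (u : monomial) : A :=
  match u with
  | Xvar i => e i
  | Xmul v w => amul (meval e v) (meval e w)
  end.

Definition satisfies A (p : zidentity) : Prop :=
  forall e : nat -> A, \sum_(lu <- p) lu.1%:~R *: meval e lu.2 = 0.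

Definition variety (E : set zidentity) A : Prop :=
  forall p, E p -> satisfies A p.

Definition subvariety (E E' : set zidentity) : Prop :=
  forall A, variety E A -> variety E' A.

Definition same_variety (E E' : set zidentity) : Prop :=
  forall A, variety E A <-> variety E' A.

End Varieties.

(* x1 x2 + x2 x1 = 0 *)
Definition anticommutativity : zidentity :=
  [:: (1, Xmul (Xvar 1) (Xvar 2)); (1, Xmul (Xvar 2) (Xvar 1))].
Definition triviality : zidentity := [:: (1, Xvar 1)].
Definition null_product : zidentity := [:: (1, Xmul (Xvar 1) (Xvar 2))].

(* One constructor per operation of the one-sorted signature 0, +, c *: _, *;
   opposites are the terms (-1) *: t. *)
Inductive term (k X : Type) :=
| Tgen of X
| Tzero
| Tadd of term k X & term k X
| Tscale of k & term k X
| Tmul of term k X & term k X.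
Arguments Tgen {k X}.
Arguments Tzero {k X}.

HB.instance Definition _ k X := gen_eqMixin (term k X).
HB.instance Definition _ k X := gen_choiceMixin (term k X).

Section FreeAlgebra.
Local Open Scope quotient_scope.
Variables (k : fieldType) (E : set zidentity) (X : Type).
Local Notation T := (term k X).
Implicit Type A : linalg k.

Fixpoint teval A (e : X -> A) (t : T) : A :=
  match t with
  | Tgen x => e x
  | Tzero => 0
  | Tadd s t => teval e s + teval e t
  | Tscale c t => c *: teval e t
  | Tmul s t => amul (teval e s) (teval e t)
  end.

(* The free algebra of the variety: terms modulo the relations that hold in
   every algebra of the variety. *)
Definition term_equiv (s t : T) : Prop :=
  forall A, variety E A -> forall e : X -> A, teval e s = teval e t.

Definition term_rel (s t : T) : bool := `[< term_equiv s t >].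

Lemma term_rel_refl : reflexive term_rel.
Proof. by move=> t; apply/asboolP. Qed.

Lemma term_rel_sym : symmetric term_rel.
Proof.
by move=> s t; apply/asboolP/asboolP => h A EA e; rewrite (h A EA e).
Qed.

Lemma term_rel_trans : transitive term_rel.
Proof.
move=> t s r /asboolP st /asboolP tr; apply/asboolP => A EA e.
by rewrite (st A EA e) (tr A EA e).
Qed.

Canonical term_eqrel :=
  EquivRel term_rel term_rel_refl term_rel_sym term_rel_trans.

Definition free_sort := {eq_quot term_eqrel}.
HB.instance Definition _ := EqQuotient.on free_sort.
HB.instance Definition _ := Choice.on free_sort.

Definition cls (t : T) : free_sort := \pi_free_sort t.

Lemma clsP s t : cls s = cls t <-> term_equiv s t.
Proof.
split=> [/eqmodP /asboolP //|h].
by apply/eqmodP; apply/asboolP.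
Qed.

Lemma clsK (a : free_sort) : cls (repr a) = a.
Proof. exact: reprK. Qed.

Lemma teval_cls A (e : X -> A) t :
  variety E A -> teval e (repr (cls t)) = teval e t.
Proof. by move=> EA; have /clsP := clsK (cls t); apply. Qed.

Definition free_zero := cls Tzero.
Definition free_add (a b : free_sort) : free_sort := cls (Tadd (repr a) (repr b)).
Definition free_scale (c : k) (a : free_sort) : free_sort := cls (Tscale c (repr a)).
Definition free_opp (a : free_sort) : free_sort := free_scale (-1) a.
Definition free_mul (a b : free_sort) : free_sort := cls (Tmul (repr a) (repr b)).

Lemma free_addA : associative free_add.
Proof. by move=> a b c; apply/clsP => A EA e /=; rewrite !teval_cls //= addrA. Qed.
Lemma free_addC : commutative free_add.
Proof. by move=> a b; apply/clsP => A EA e /=; rewrite addrC. Qed.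
Lemma free_add0 : left_id free_zero free_add.
Proof.
by move=> a; rewrite -[RHS]clsK; apply/clsP => A EA e /=;
  rewrite teval_cls //= add0r.
Qed.
Lemma free_addN : left_inverse free_zero free_opp free_add.
Proof.
by move=> a; apply/clsP => A EA e /=; rewrite teval_cls //= scaleN1r addNr.
Qed.

HB.instance Definition _ := GRing.isZmodule.Build free_sort
  free_addA free_addC free_add0 free_addN.

Lemma free_scaleA c d a : free_scale c (free_scale d a) = free_scale (c * d) a.
Proof. by apply/clsP => A EA e /=; rewrite teval_cls //= scalerA. Qed.
Lemma free_scale1 : left_id 1 free_scale.
Proof.
by move=> a; rewrite -[RHS]clsK; apply/clsP => A EA e /=; rewrite scale1r.
Qed.
Lemma free_scaleDr : right_distributive free_scale +%R.
Proof.
by move=> c a b; apply/clsP => A EA e /=; rewrite !teval_cls //= scalerDr.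
Qed.
Lemma free_scaleDl a : {morph free_scale^~ a : c d / c + d}.
Proof.
by move=> c d; apply/clsP => A EA e /=; rewrite !teval_cls //= scalerDl.
Qed.

HB.instance Definition _ := GRing.Zmodule_isLmodule.Build k free_sort
  free_scaleA free_scale1 free_scaleDr free_scaleDl.

Lemma teval_repr_linear A (e : X -> A) (c : k) (a b : free_sort) :
  variety E A ->
  teval e (repr (c *: a + b)) = c *: teval e (repr a) + teval e (repr b).
Proof. by move=> EA; rewrite teval_cls //= teval_cls. Qed.

Lemma teval_repr_mul A (e : X -> A) (a b : free_sort) :
  variety E A ->
  teval e (repr (free_mul a b)) = amul (teval e (repr a)) (teval e (repr b)).
Proof. by move=> EA; rewrite teval_cls. Qed.

Lemma free_mul_bilinear : bilinear_for *:%R *:%R free_mul.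
Proof.
split=> a c u v; rewrite -[LHS]clsK -[RHS]clsK; apply/clsP => A EA e.
- by rewrite teval_repr_linear // !teval_repr_mul // teval_repr_linear //
    linearPl.
- by rewrite teval_repr_linear // !teval_repr_mul // teval_repr_linear //
    linearPr.
Qed.

HB.instance Definition _ := bilinear_isBilinear.Build
  k free_sort free_sort free_sort *:%R *:%R free_mul free_mul_bilinear.

Definition free_alg : linalg k := LinAlg free_mul.
Definition free_gen (x : X) : free_alg := cls (Tgen x).

Section Evaluation.
Variables (A : linalg k) (EA : variety E A) (e : X -> A).

Definition free_eval (a : free_alg) : A := teval e (repr (a : free_sort)).

Lemma free_eval_linear : linear free_eval.
Proof. by move=> c a b; exact: teval_repr_linear. Qed.

HB.instance Definition _ :=
  GRing.isLinear.Build k free_alg A *:%R free_eval free_eval_linear.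

Lemma free_evalM (a b : free_alg) :
  free_eval (amul a b) = amul (free_eval a) (free_eval b).
Proof. exact: teval_repr_mul. Qed.

Definition free_eval_hom : alg_hom free_alg A :=
  @AlgHom k free_alg A free_eval free_evalM.

End Evaluation.

Lemma hom_meval A B (h : alg_hom A B) (e : nat -> A) u :
  h (meval e u) = meval (h \o e) u.
Proof. by elim: u => //= u IHu v IHv; rewrite alg_homM IHu IHv. Qed.

Lemma free_alg_variety : variety E free_alg.
Proof.
move=> p Ep f; rewrite -[LHS]clsK; apply/clsP => A EA e /=.
rewrite -[LHS]/(free_eval_hom EA e _) raddf_sum /=.
apply: etrans (EA p Ep (free_eval_hom EA e \o f)).
by apply: eq_bigr => lu _; rewrite linearZ /= (hom_meval (free_eval_hom EA e)).
Qed.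

Lemma free_algP A (e : X -> A) : variety E A ->
  exists! h : alg_hom free_alg A, forall x, h (free_gen x) = e x.
Proof.
move=> EA; exists (free_eval_hom EA e); split=> [x|h hP].
  by rewrite /= /free_eval teval_cls.
apply: alg_hom_ext => a; rewrite -[a]clsK /= /free_eval teval_cls //.
elim: (repr a) => {a} [x||s IHs t IHt|c t IHt|s IHs t IHt] /=.
- by rewrite -hP.
- by apply/esym; exact: (raddf0 h).
- rewrite IHs IHt -raddfD; congr (h _); apply/clsP => B EB f /=.
  by rewrite !teval_cls.
- rewrite IHt -linearZ; congr (h _); apply/clsP => B EB f /=.
  by rewrite !teval_cls.
- rewrite IHs IHt; apply: etrans (esym (alg_homM h (cls s) (cls t))) _.
  congr (h _); apply/clsP => B EB f /=.
  by rewrite !teval_cls.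
Qed.

End FreeAlgebra.

(* X_0 = {x_0, x_1, ...} is represented by nat, and the object X stands for F(X):
   in a variety with a nonzero algebra F(X) and F(Y) are different objects when
   X <> Y, even if they are isomorphic. *)
Definition free_cat (k : fieldType) (E : set zidentity) : category :=
  @Category {fset nat}
    (fun X Y => alg_hom (free_alg k E X) (free_alg k E Y))
    (fun X => alg_id (free_alg k E X))
    (fun _ _ _ f g => alg_comp f g)
    (fun _ _ => @alg_comp_idl _ _ _)
    (fun _ _ => @alg_comp_idr _ _ _)
    (fun _ _ _ _ => @alg_compA _ _ _ _ _).

(* Main.v *)
(* An automorphism F of the category sends F(x) to a free algebra on one
   generator, since the endomorphisms of F(x) = k x commute and those of a free
   algebra on two or more generators do not. Viewing an element a of F(X) as the
   morphism F(x) -> F(X), x |-> a, one obtains bijections s : F(X) -> F(X') onto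
   the images of the objects, natural in the sense that F(f) s = s f. Hence
   s(c a) = phi(c) s(a), and s(a + b), s(a b) are given by words w, p in s(a),
   s(b). As s is compatible with the rescaling of the variables, w and p are
   homogeneous of degree 1 and 2, and anticommutativity leaves only
   s(a + b) = s(a) + s(b) and s(a b) = g s(a) s(b) with g <> 0. So phi is a field
   automorphism and F is isomorphic to the conjugation by the phi-semilinear
   automorphisms fixing the generators, which exist because the identities have
   integer coefficients. Such a conjugation is inner only if phi = 1, as one sees
   on the endomorphisms x |-> c x of F(x). *)

From HB Require Import structures.
Require Import Defs.
From mathcomp Require Import all_boot all_algebra.
From mathcomp Require Import finmap.
From mathcomp Require Import boolp classical_sets.

Set Implicit Arguments.
Unset Strict Implicit.
Unset Printing Implicit Defensive.

Import GRing.Theory.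
Local Open Scope ring_scope.

(** * Bilinear arithmetic and homomorphisms out of free algebras *)

Section Products.
Variables (k : fieldType) (A : linalg k).
Implicit Types a b c : A.

Lemma amul0l a : amul 0 a = 0.
Proof. exact: linear0l. Qed.
Lemma amul0r a : amul a 0 = 0.
Proof. exact: linear0r. Qed.
Lemma amulDl a b c : amul (a + b) c = amul a c + amul b c.
Proof. exact: linearDl. Qed.
Lemma amulDr a b c : amul a (b + c) = amul a b + amul a c.
Proof. exact: linearDr. Qed.
Lemma amulZl x a b : amul (x *: a) b = x *: amul a b.
Proof. exact: linearZl_LR. Qed.
Lemma amulZr x a b : amul a (x *: b) = x *: amul a b.
Proof. exact: linearZr_LR. Qed.

Lemma alg_homZ (B : linalg k) (f : alg_hom A B) x a : f (x *: a) = x *: f a.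
Proof. exact: (linearZ_LR (alg_fun f)). Qed.

Lemma alg_homD (B : linalg k) (f : alg_hom A B) a b : f (a + b) = f a + f b.
Proof. exact: (raddfD (alg_fun f)). Qed.
Lemma alg_hom0 (B : linalg k) (f : alg_hom A B) : f 0 = 0.
Proof. exact: (raddf0 (alg_fun f)). Qed.

End Products.

Section FreeHoms.
Variables (k : fieldType) (E : set zidentity) (X : Type).
Local Notation F := (free_alg k E X).
Local Notation gen := (@free_gen k E X).

Lemma free_eval_gen (A : linalg k) (EA : variety E A) (e : X -> A) x :
  free_eval_hom EA e (gen x) = e x.
Proof. by rewrite /= /free_eval teval_cls. Qed.

Lemma free_hom_ext (A : linalg k) (EA : variety E A) (f g : alg_hom F A) :
  (forall x, f (gen x) = g (gen x)) -> f = g.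
Proof.
move=> fg; have [h [_ hU]] := free_algP (fun x => g (gen x)) EA.
by rewrite -(hU f) // -(hU g).
Qed.

Lemma free_ind (P : F -> Prop) :
  (forall x, P (gen x)) -> P 0 -> (forall a b, P a -> P b -> P (a + b)) ->
  (forall c a, P a -> P (c *: a)) -> (forall a b, P a -> P b -> P (amul a b)) ->
  forall a, P a.
Proof.
move=> Pg P0 PD PZ PM a; rewrite -[a]clsK.
elim: (repr a) => {a} [x||s IHs t IHt|c t IHt|s IHs t IHt].
- exact: Pg.
- exact: P0.
- suff -> : cls E (Tadd s t) = (cls E s : F) + cls E t by exact: PD.
  by apply/clsP => A EA e /=; rewrite !teval_cls.
- suff -> : cls E (Tscale c t) = c *: (cls E t : F) by exact: PZ.
  by apply/clsP => A EA e /=; rewrite !teval_cls.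
- suff -> : cls E (Tmul s t) = amul (cls E s : F) (cls E t) by exact: PM.
  by apply/clsP => A EA e /=; rewrite !teval_cls.
Qed.

End FreeHoms.

(* The algebra with the same ring structure as A in which the scalar c acts as
   phi c: a phi-semilinear multiplicative map B -> A is the same thing as a
   homomorphism B -> twist_alg phi A. *)
Definition twist (k : fieldType) (phi : {rmorphism k -> k}) (A : linalg k) :
  Type := A.

(** * Semilinear automorphisms of free algebras and conjugation by them *)

Section Twist.
Variables (k : fieldType) (phi : {rmorphism k -> k}) (A : linalg k).
Local Notation tA := (twist phi A).

HB.instance Definition _ := GRing.Zmodule.copy tA (A : zmodType).

Definition twist_scale (c : k) (a : tA) : tA := phi c *: (a : A).

Lemma twist_scaleA c d a : twist_scale c (twist_scale d a) = twist_scale (c * d) a.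
Proof. by rewrite /twist_scale scalerA rmorphM. Qed.
Lemma twist_scale1 : left_id 1 twist_scale.
Proof. by move=> a; rewrite /twist_scale rmorph1 scale1r. Qed.
Lemma twist_scaleDr : right_distributive twist_scale +%R.
Proof. by move=> c a b; exact: scalerDr. Qed.
Lemma twist_scaleDl a : {morph twist_scale^~ a : c d / c + d}.
Proof. by move=> c d; rewrite /twist_scale rmorphD; exact: scalerDl. Qed.

HB.instance Definition _ := GRing.Zmodule_isLmodule.Build k tA
  twist_scaleA twist_scale1 twist_scaleDr twist_scaleDl.

Definition twist_mul (a b : tA) : tA := amul (a : A) (b : A).

Lemma twist_mul_bilinear : bilinear_for *:%R *:%R twist_mul.
Proof.
split=> a c u v; first exact: (linearPl (amul : {bilinear A -> A -> A})).
exact: (linearPr (amul : {bilinear A -> A -> A})).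
Qed.

HB.instance Definition _ := bilinear_isBilinear.Build
  k tA tA tA *:%R *:%R twist_mul twist_mul_bilinear.

Definition twist_alg : linalg k := LinAlg twist_mul.

Lemma meval_twist (e : nat -> A) u :
  meval (A := twist_alg) e u = meval (A := A) e u.
Proof. by elim: u => //= u -> v ->. Qed.

(** A ring morphism fixes the image of every integer, so identities with integer coefficients do not
    see the twist. *)
Lemma twist_variety E : variety E A -> variety E twist_alg.
Proof.
move=> EA p Ep e; rewrite -[RHS](EA p Ep e); apply: eq_bigr => lu _.
by rewrite meval_twist -[LHS]/(phi lu.1%:~R *: (meval (A := A) e lu.2)) rmorph_int.
Qed.

End Twist.

Section SemilinearAutomorphism.
Variables (k : fieldType) (E : set zidentity).

Section Transport.
Variables (phi : {rmorphism k -> k}) (X : Type).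
Local Notation F := (free_alg k E X).

Definition semilin_hom : alg_hom F (twist_alg phi F) :=
  free_eval_hom (twist_variety (phi := phi) (@free_alg_variety k E X))
    (fun x => free_gen k E x).

Definition semilin (a : F) : F := semilin_hom a.

Lemma semilin_gen x : semilin (free_gen k E x) = free_gen k E x.
Proof. exact: (free_eval_gen (A := twist_alg phi F)). Qed.
Lemma semilinD a b : semilin (a + b) = semilin a + semilin b.
Proof. exact: (raddfD semilin_hom). Qed.
Lemma semilinZ c a : semilin (c *: a) = phi c *: semilin a.
Proof. exact: (linearZ_LR semilin_hom). Qed.
Lemma semilinM a b : semilin (amul a b) = amul (semilin a) (semilin b).
Proof. exact: (alg_homM semilin_hom). Qed.
Lemma semilin0 : semilin 0 = 0.
Proof. exact: (raddf0 semilin_hom). Qed.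

End Transport.

(** The pointwise equation for [chi] lets the lemma apply both to the identity and to products in
    [field_aut]. *)
Lemma semilin_comp (phi psi chi : {rmorphism k -> k}) X (a : free_alg k E X) :
  (forall c, phi (psi c) = chi c) -> semilin phi (semilin psi a) = semilin chi a.
Proof.
move=> chiE; elim/free_ind: a => [x||a b IHa IHb|c a IHa|a b IHa IHb].
- by rewrite !semilin_gen.
- by rewrite !semilin0.
- by rewrite !semilinD IHa IHb.
- by rewrite !semilinZ IHa chiE.
- by rewrite !semilinM IHa IHb.
Qed.

Lemma semilin_id (phi : {rmorphism k -> k}) X (a : free_alg k E X) :
  (forall c, phi c = c) -> semilin phi a = a.
Proof.
move=> phiE; elim/free_ind: a => [x||a b IHa IHb|c a IHa|a b IHa IHb].
- exact: semilin_gen.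
- exact: semilin0.
- by rewrite semilinD IHa IHb.
- by rewrite semilinZ IHa phiE.
- by rewrite semilinM IHa IHb.
Qed.

Section Conjugation.
Variable phi : field_aut k.
Local Notation up := (uval phi : {rmorphism k -> k}).
Local Notation um := (uinv phi : {rmorphism k -> k}).

Lemma field_autVK c : up (um c) = c.
Proof. exact: (congr1 (fun f : field_end k => f c) (umulV phi)). Qed.
Lemma field_autKV c : um (up c) = c.
Proof. exact: (congr1 (fun f : field_end k => f c) (uVmul phi)). Qed.

Lemma semilinVK X (a : free_alg k E X) : semilin up (semilin um a) = a.
Proof.
rewrite (@semilin_comp _ _ idfun); first exact: semilin_id.
exact: field_autVK.
Qed.
Lemma semilinKV X (a : free_alg k E X) : semilin um (semilin up a) = a.
Proof.
rewrite (@semilin_comp _ _ idfun); first exact: semilin_id.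
exact: field_autKV.
Qed.

Section Hom.
Variables (X Y : Type) (f : alg_hom (free_alg k E X) (free_alg k E Y)).

Definition conj_fun (a : free_alg k E X) : free_alg k E Y :=
  semilin up (f (semilin um a)).

Lemma conj_fun_linear : linear conj_fun.
Proof.
move=> c a b.
by rewrite /conj_fun semilinD semilinZ linearP semilinD semilinZ field_autVK.
Qed.

HB.instance Definition _ := GRing.isLinear.Build k
  (free_alg k E X) (free_alg k E Y) *:%R conj_fun conj_fun_linear.

Lemma conj_funM a b : conj_fun (amul a b) = amul (conj_fun a) (conj_fun b).
Proof. by rewrite /conj_fun semilinM alg_homM semilinM. Qed.

Definition conj_hom : alg_hom (free_alg k E X) (free_alg k E Y) :=
  AlgHom conj_funM.

Lemma conj_hom_semilin a : conj_hom (semilin up a) = semilin up (f a).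
Proof. by rewrite /= /conj_fun semilinKV. Qed.

End Hom.

Lemma conj_hom_id (X : free_cat k E) : conj_hom (idm X) = idm X.
Proof. by apply: alg_hom_ext => a; exact: semilinVK. Qed.

Lemma conj_hom_comp (X Y Z : free_cat k E) (f : Defs.hom Y Z) (g : Defs.hom X Y) :
  conj_hom (Defs.comp f g) =
    Defs.comp (conj_hom f : Defs.hom Y Z) (conj_hom g : Defs.hom X Y).
Proof. by apply: alg_hom_ext => a; rewrite /= /conj_fun semilinKV. Qed.

Definition conj_functor : endofunctor (free_cat k E) :=
  @Endofunctor (free_cat k E) id (fun X Y f => conj_hom f)
    conj_hom_id conj_hom_comp.

End Conjugation.

(** Sharing the object map [o] puts both morphism maps in one type, so the comparison involves no
    transport. *)
Lemma endofunctor_eq (C : category) (o : C -> C)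
    (m m' : forall a b : C, Defs.hom a b -> Defs.hom (o a) (o b)) i i' c c' :
  (forall a b f, m a b f = m' a b f) ->
  @Endofunctor C o m i c = @Endofunctor C o m' i' c'.
Proof.
move=> e; have em : m = m'.
  by apply: functional_extensionality_dep => a;
     apply: functional_extensionality_dep => b; exact: funext.
by subst m'; congr Endofunctor; exact: Prop_irrelevance.
Qed.

Lemma conj_functorM (phi psi : field_aut k) :
  conj_functor (phi * psi)%g = (conj_functor phi * conj_functor psi)%g.
Proof.
apply: endofunctor_eq => X Y f; apply: alg_hom_ext => a.
have uinvM : semilin (uinv psi : field_end k) (semilin (uinv phi : field_end k) a)
    = semilin (uinv (phi * psi)%g : field_end k) a by exact: semilin_comp.
have uvalM b : semilin (uval phi : field_end k) (semilin (uval psi : field_end k) b)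
    = semilin (uval (phi * psi)%g : field_end k) b :> free_alg k E Y.
  exact: semilin_comp.
apply: etrans (esym (uvalM _)); exact: (congr1 _ (congr1 f (esym uinvM))).
Qed.

Lemma conj_functor1 : conj_functor 1%g = 1%g.
Proof.
apply: endofunctor_eq => X Y f; apply: alg_hom_ext => a.
by rewrite /= /conj_fun !semilin_id.
Qed.

Lemma conj_functorV (phi : field_aut k) :
  (conj_functor phi * conj_functor phi^-1 = 1)%g.
Proof. by rewrite -conj_functorM mulgV conj_functor1. Qed.
Lemma conj_functorVl (phi : field_aut k) :
  (conj_functor phi^-1 * conj_functor phi = 1)%g.
Proof. by rewrite -conj_functorM mulVg conj_functor1. Qed.

Definition conj_aut (phi : field_aut k) : cat_aut (free_cat k E) :=
  MUnit (conj_functorV phi) (conj_functorVl phi).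

Lemma conj_autM phi psi : conj_aut (phi * psi)%g = (conj_aut phi * conj_aut psi)%g.
Proof. by apply: munit_inj; exact: conj_functorM. Qed.

End SemilinearAutomorphism.

Lemma natf_inj (k : fieldType) : [pchar k] =i pred0 -> injective (fun n => n%:R : k).
Proof.
move=> char0; have /pcharf0P nat0 := char0.
have half m n : (m <= n)%N -> m%:R = n%:R :> k -> m = n.
  move=> mn emn; have /eqP : ((n - m)%N%:R == 0 :> k).
    by rewrite natrB // emn subrr.
  by move/eqP; rewrite nat0 subn_eq0 => nm; apply/eqP; rewrite eqn_leq mn.
move=> m n /= e; case: (leqP m n) => [mn|/ltnW nm]; first exact: half.
by apply/esym/half.
Qed.

(** Equality on monomials makes membership in an identity, viewed as a sequence, available to
    [null_variety]. *)
HB.instance Definition _ := gen_eqMixin monomial.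

(** * Consequences of anticommutativity and nontriviality in free algebras *)

Section Anticommutative.
Variables (k : fieldType) (char0 : [pchar k] =i pred0) (E : set zidentity).
Hypothesis anti : subvariety k E [set anticommutativity].
Local Notation F := (free_alg k E).
Local Notation gen := (@free_gen k E _).

Lemma amulC (A : linalg k) (EA : variety E A) (a b : A) :
  amul a b = - amul b a.
Proof.
have /(_ anticommutativity erefl) := anti EA.
move/(_ (fun i => if i == 1%N then a else b)).
rewrite !big_cons big_nil /= addr0 !scale1r => /eqP.
by rewrite addr_eq0 => /eqP.
Qed.

Lemma amul_sq (A : linalg k) (EA : variety E A) (a : A) : amul a a = 0.
Proof.
have /eqP := amulC EA a a; rewrite -addr_eq0 -mulr2n -scaler_nat scaler_eq0.
by have /pcharf0P -> := char0; rewrite /= => /eqP.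
Qed.

Lemma free_algE X : variety E (F X).
Proof. exact: free_alg_variety. Qed.
Local Hint Resolve free_algE : core.

(** Multiples of a single generator are closed under products because squares vanish. *)
Lemma free_one_line (X : Type) (x : X) : (forall y, y = x) ->
  forall a : F X, exists c, a = c *: gen x.
Proof.
move=> Xx; elim/free_ind => [y||a b [c ->] [d ->]|d a [c ->]|a b [c ->] [d ->]].
- by rewrite (Xx y); exists 1; rewrite scale1r.
- by exists 0; rewrite scale0r.
- by exists (c + d); rewrite scalerDl.
- by exists (d * c); rewrite scalerA.
- by exists 0; rewrite amulZl amulZr amul_sq // !scaler0 scale0r.
Qed.

Section NontrivialVariety.
Hypothesis nontriv : ~ same_variety k E [set triviality].

(** A generator can be sent to any element of any algebra of the variety; if it were 0, all these
    algebras would be zero. *)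
Lemma gen_neq0 (X : Type) (x : X) : gen x <> 0 :> F X.
Proof.
move=> gx0; apply: nontriv => A; split=> [EA p -> e|A0 p Ep e].
  rewrite big_cons big_nil /= addr0 scale1r.
  have := free_eval_gen EA (fun _ : X => e 1%N) x.
  by rewrite gx0 alg_hom0.
have a0 (a : A) : a = 0.
  have /(_ (fun=> a)) := A0 _ erefl.
  by rewrite big_cons big_nil /= addr0 scale1r.
exact: a0.
Qed.

Lemma scale_gen_inj (X : Type) (x : X) (c d : k) :
  c *: (gen x : F X) = d *: gen x -> c = d.
Proof.
move/eqP; rewrite -subr_eq0 -scalerBl scaler_eq0 subr_eq0.
by case/orP => /eqP // gx0; have := gen_neq0 gx0.
Qed.

(** Evaluate an identity in the free algebra on one generator, sending variable [i] to the generator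
    and the others to 0. Monomials of higher degree vanish, so the coefficients of variable [i] add
    up to 0. In [N] only these sums survive. *)
Lemma null_variety (N : linalg k) :
  (forall a b : N, amul a b = 0) -> variety E N.
Proof.
move=> N0 p Ep e.
pose coefd u i : k := if u is Xvar j then (j == i)%:R else 0.
have coef0 i : \sum_(lu <- p) lu.1%:~R * coefd lu.2 i = 0.
  apply: (@scale_gen_inj unit tt); rewrite scale0r scaler_suml.
  rewrite -[RHS](free_algE Ep (fun j => (j == i)%:R *: gen tt)).
  apply: eq_bigr => lu _; rewrite -scalerA; congr (_ *: _).
  case: lu.2 => [//|u v].
  set ev : nat -> F unit := fun j => _; rewrite -[RHS]/(amul (meval ev u) (meval ev v)).
  have [c ->] : exists c, meval ev u = c *: (gen tt : F unit).
    by apply: free_one_line; case.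
  have [d ->] : exists d, meval ev v = d *: (gen tt : F unit).
    by apply: free_one_line; case.
  by rewrite amulZl amulZr amul_sq // !scaler0 scale0r.
(* [M] exceeds the index of every variable that occurs in [p] as a monomial; products get the
   default index 0. *)
pose idx u := if u is Xvar j then j else 0%N.
pose M := (\max_(lu <- p) idx lu.2).+1.
transitivity (\sum_(lu <- p) \sum_(i < M) (lu.1%:~R * coefd lu.2 i) *: e i).
  apply: eq_big_seq => -[l u] lup /=.
  transitivity (l%:~R *: \sum_(i < M) coefd u i *: e i); last first.
    by rewrite scaler_sumr; apply: eq_bigr => i _; rewrite scalerA.
  congr (_ *: _); case: u lup => [j|u v] lup /=; last first.
    by rewrite N0 big1 // => i _; rewrite scale0r.
  have jM : (j < M)%N
    by rewrite ltnS; apply: (@leq_bigmax_seq _ _ _ (fun lu => idx lu.2) _ lup).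
  rewrite (bigD1 (Ordinal jM)) //= eqxx scale1r big1 ?addr0 // => i.
  by rewrite -val_eqE /= eq_sym => /negPf ->; rewrite scale0r.
rewrite exchange_big big1 //= => i _.
by rewrite -scaler_suml coef0 scale0r.
Qed.

Hypothesis nonnull : ~ same_variety k E [set null_product].

(** If the product were 0, all products in the variety would vanish; with [null_variety] for the
    converse inclusion, this contradicts [nonnull]. *)
Lemma amul_gen_neq0 (X : eqType) (x y : X) :
  x != y -> amul (gen x) (gen y) <> 0 :> F X.
Proof.
move=> xy gxy0; apply: nonnull => A; split=> [EA p -> e|A0].
  rewrite big_cons big_nil /= addr0 scale1r.
  have := alg_homM (free_eval_hom EA (fun z => if z == x then e 1%N else e 2%N))
    (gen x) (gen y).
  by rewrite gxy0 alg_hom0 !free_eval_gen eqxx eq_sym (negPf xy).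
apply: null_variety => a b.
have /(_ (fun i => if i == 1%N then a else b)) := A0 _ erefl.
by rewrite big_cons big_nil /= addr0 scale1r.
Qed.

End NontrivialVariety.

(** * Homogeneous elements in two generators *)

Section TwoGenerators.
Variables (X : Type) (x y : X) (Xxy : forall z, z = x \/ z = y).
Local Notation FX := (F X).

(** In characteristic 0 the powers of 2 are distinct, so the eigenvalues of this rescaling separate
    the degrees. *)
Definition double : alg_hom FX FX :=
  free_eval_hom (@free_algE X) (fun z => 2%:R *: gen z).
Arguments double : simpl never.

(* Homogeneity of degree n >= 3 is only recorded as an eigenvalue condition. *)
Definition graded (n : nat) (a : FX) : Prop :=
  match n with
  | 0 => a = 0
  | 1 => exists c d, a = c *: gen x + d *: gen y
  | 2 => exists c, a = c *: amul (gen x) (gen y)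
  | _ => double a = 2%:R ^+ n *: a
  end.

Lemma double_gen z : double (gen z) = 2%:R *: gen z.
Proof. exact: free_eval_gen. Qed.

Lemma graded_double n a : graded n a -> double a = 2%:R ^+ n *: a.
Proof.
case: n => [->|[[c [d ->]]|[[c ->]|//]]].
- by rewrite alg_hom0 scaler0.
- by rewrite alg_homD !alg_homZ /= !double_gen expr1 scalerDr !scalerA ![_ * 2%:R]mulrC.
- rewrite alg_homZ alg_homM !double_gen amulZl amulZr !scalerA.
  by congr (_ *: _); rewrite expr2 [RHS]mulrC ?mulrA.
Qed.

Lemma eigen_graded3 n a : double a = 2%:R ^+ n.+3 *: a -> graded n.+3 a.
Proof. by []. Qed.

Lemma graded0 n : graded n 0.
Proof.
case: n => [//|[|[|n]]].
- by exists 0, 0; rewrite !scale0r addr0.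
- by exists 0; rewrite scale0r.
- by apply: eigen_graded3; rewrite alg_hom0 scaler0.
Qed.

Lemma gradedD n a b : graded n a -> graded n b -> graded n (a + b).
Proof.
case: n => [-> ->|[[c [d ->]] [c' [d' ->]]|[[c ->] [d ->]|
  n /graded_double ea /graded_double eb]]].
- exact: addr0.
- by exists (c + c'), (d + d'); rewrite !scalerDl addrACA.
- by exists (c + d); rewrite scalerDl.
- by apply: eigen_graded3; rewrite alg_homD ea eb scalerDr.
Qed.

Lemma gradedZ n c a : graded n a -> graded n (c *: a).
Proof.
case: n => [->|[[d [d' ->]]|[[d ->]|n /graded_double ea]]].
- exact: scaler0.
- by exists (c * d), (c * d'); rewrite scalerDr !scalerA.
- by exists (c * d); rewrite scalerA.
- by apply: eigen_graded3; rewrite alg_homZ ea !scalerA mulrC.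
Qed.

Lemma gradedM n m a b : graded n a -> graded m b -> graded (n + m) (amul a b).
Proof.
case: n => [->|n]; first by rewrite amul0l => _; apply: (graded0 m).
case: m => [|m]; first by move=> _ ->; rewrite amul0r; apply: (graded0 (n.+1 + 0)).
(* Unless both degrees are 1, the total degree is at least 3 and the eigenvalue condition
   suffices. *)
case: n => [|n]; case: m => [|m]; last 3 first.
1-3: move=> /graded_double ea /graded_double eb.
1-3: rewrite !addnS ?addSn; apply: eigen_graded3.
1-3: by rewrite alg_homM ea eb amulZl amulZr scalerA -exprD !addnS ?addSn.
move=> [c [d ->]] [c' [d' ->]]; exists (c * d' - d * c').
rewrite amulDl !amulDr !amulZl !amulZr !amul_sq // !scaler0 add0r addr0.
by rewrite (amulC _ (gen y)) // !scalerN !scalerA scalerBl.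
Qed.

(** The index counts summands, not degrees: it is the measure for the induction in [eigen_graded].
    Degrees may repeat and come in any order. *)
Inductive gsum : nat -> FX -> Prop :=
| Gsum0 : gsum 0 0
| GsumS n d v a : graded d v -> gsum n a -> gsum n.+1 (v + a).

Lemma gsum1 d v : graded d v -> gsum 1 v.
Proof. by move=> gv; rewrite -[v]addr0; exact: GsumS gv Gsum0. Qed.

Lemma gsumD n m a b : gsum n a -> gsum m b -> gsum (n + m) (a + b).
Proof.
move=> ga gb; elim: ga => [|{}n d v {}a gv _ IH]; first by rewrite add0r.
by rewrite addSn -addrA; exact: GsumS gv IH.
Qed.

Lemma gsumM n m a b : gsum n a -> gsum m b -> exists p, gsum p (amul a b).
Proof.
move=> ga gb; elim: ga => [|{}n d v {}a gv _ [p IH]].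
  by exists 0%N; rewrite amul0l; exact: Gsum0.
exists (m + p)%N; rewrite amulDl; apply: gsumD IH.
elim: gb => [|{}m e w {}b gw _ IH]; first by rewrite amul0r; exact: Gsum0.
by rewrite amulDr; exact: GsumS (gradedM gv gw) IH.
Qed.

Lemma gsumP a : exists n, gsum n a.
Proof.
elim/free_ind: a => [z||a b [n ga] [m gb]|c a [n ga]|a b [n ga] [m gb]].
- exists 1%N; apply: (@gsum1 1); case: (Xxy z) => ->.
    by exists 1, 0; rewrite scale1r scale0r addr0.
  by exists 0, 1; rewrite scale1r scale0r add0r.
- by exists 0%N; exact: Gsum0.
- by exists (n + m)%N; exact: gsumD.
- exists n; elim: ga => [|{}n d v {}a gv _ IH]; first by rewrite scaler0; exact: Gsum0.
  by rewrite scalerDr; exact: GsumS (gradedZ c gv) IH.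
- exact: gsumM ga gb.
Qed.

(* double - 2^d kills the summand of degree d and rescales the others, so the
   number of summands can be decreased. *)
Lemma eigen_graded m a : double a = 2%:R ^+ m *: a -> graded m a.
Proof.
have [n ga] := gsumP a; elim: n a ga => [|n IH] a ga.
  by inversion ga; move=> _; exact: graded0.
inversion ga as [|n' d v b gv gb en ea]; subst n' a => {ga} dvb.
(* If [d = m], then [b] is itself an eigenvector for [2 ^ m], and the induction applies to it
   directly. *)
have [edm|ndm] := eqVneq d m.
  subst d; apply: (gradedD gv); apply: IH => //.
  apply: (addrI (double v)); rewrite -alg_homD dvb (graded_double gv).
  by rewrite scalerDr.
(* On the eigenvector [v + b] the operator [double - 2 ^ d] acts as this nonzero scalar, which is
   divided out below. *)
set c : k := 2%:R ^+ m - 2%:R ^+ d.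
have c0 : c != 0.
  rewrite subr_eq0 -!natrX; apply: contra_neq ndm => /(natf_inj char0) /eqP.
  by rewrite eqn_exp2l // => /eqP.
have ec : c *: (v + b) = double b - 2%:R ^+ d *: b.
  rewrite scalerBl -dvb alg_homD scalerDr (graded_double gv) opprD.
  by rewrite addrACA subrr add0r.
rewrite -[_ + _](scalerK c0); apply: gradedZ; apply: IH; last first.
  by rewrite alg_homZ dvb !scalerA mulrC.
rewrite ec {ec dvb}; elim: gb => [|{}n e w {}b gw _ IH].
  by rewrite alg_hom0 scaler0 subr0; exact: Gsum0.
rewrite alg_homD scalerDr opprD addrACA; apply: GsumS IH.
by rewrite (graded_double gw) -scalerBl; exact: gradedZ gw.
Qed.

End TwoGenerators.

End Anticommutative.

(** * Faithfulness and fullness of automorphisms of a category *)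

Section Equivalences.
Variables (C : category) (F G : endofunctor C).

Lemma faithful_of_retraction : isomorphic_functors (fid C) (fcomp G F) ->
  forall a b (f g : Defs.hom a b), fmap F f = fmap F g -> f = g.
Proof.
case=> s [iso_s nat_s] a b f g efg.
have [t [ts _]] := iso_s b.
rewrite -[f]comp_idl -[g]comp_idl -ts -!Defs.compA; congr Defs.comp.
by have := nat_s a b f; rewrite /= efg => <-; exact: nat_s.
Qed.

End Equivalences.

(** [G] is faithful, so it suffices to solve [G (F f) = G h]; the naturality square of [s] then
    dictates [f]. *)
Lemma full_of_inverse (C : category) (F G : endofunctor C) :
  isomorphic_functors (fid C) (fcomp G F) ->
  isomorphic_functors (fid C) (fcomp F G) ->
  forall a b (h : Defs.hom (F a) (F b)), exists f, fmap F f = h.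
Proof.
move=> [s [iso_s nat_s]] FG a b h.
have [t [_ st]] := iso_s b; have [t' [_ st']] := iso_s a.
exists (Defs.comp t (Defs.comp (fmap G h) (s a))).
apply: (faithful_of_retraction FG).
set f := Defs.comp t _.
rewrite -[LHS]comp_idr -[RHS]comp_idr -st' !Defs.compA; congr Defs.comp.
have /= -> := nat_s a b f.
by rewrite /f Defs.compA st comp_idl.
Qed.

Section CategoryAutomorphisms.
Variables (C : category) (U : cat_aut C).
Local Notation F := (uval U : endofunctor C).

Lemma cat_aut_inv : fcomp (uinv U) F = fid C.
Proof. exact: uVmul. Qed.
Lemma cat_aut_invr : fcomp F (uinv U) = fid C.
Proof. exact: umulV. Qed.

Lemma cat_aut_faithful a b (f g : Defs.hom a b) : fmap F f = fmap F g -> f = g.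
Proof.
apply: (faithful_of_retraction (G := uinv U)).
by rewrite cat_aut_inv; exact: isofun_refl.
Qed.

Lemma cat_aut_full a b (h : Defs.hom (F a) (F b)) : exists f, fmap F f = h.
Proof.
apply: (full_of_inverse (G := uinv U)).
  by rewrite cat_aut_inv; exact: isofun_refl.
by rewrite cat_aut_invr; exact: isofun_refl.
Qed.

Lemma cat_aut_surj b : exists a, F a = b.
Proof.
by exists ((uinv U : endofunctor C) b);
  exact: (congr1 (fun H : endofunctor C => fobj H b) cat_aut_invr).
Qed.

(** Applying the inverse of [U] to the isomorphism exhibits the quotient of [V] by [U] as inner. *)
Lemma coset_rel_isofun (V : cat_aut C) :
  isomorphic_functors F (uval V) -> coset_rel (inner_auts C) U V.
Proof.
move=> FV; apply/asboolP.
have := isofun_compl (uinv U) FV.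
by rewrite cat_aut_inv.
Qed.

End CategoryAutomorphisms.

(** * Bundling of bijections into algebra isomorphisms and field automorphisms *)

Lemma alg_hom_of_fun (k : fieldType) (A B : linalg k) (f : A -> B) :
  linear f -> (forall a b, f (amul a b) = amul (f a) (f b)) ->
  {h : alg_hom A B | forall a, h a = f a}.
Proof.
move=> fl fM.
pose fm := GRing.isLinear.Build k A B *:%R f fl.
pose fL : {linear A -> B} := HB.pack f fm.
by exists (@AlgHom k A B fL fM).
Qed.

Lemma alg_hom_inverse (k : fieldType) (A B : linalg k) (f : alg_hom A B) :
  injective f -> (forall b, exists a, f a = b) ->
  exists g : alg_hom B A, cancel f g /\ cancel g f.
Proof.
move=> f_inj f_surj; pose g b := sval (cid (f_surj b)).
have fK b : f (g b) = b by exact: svalP (cid (f_surj b)).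
have gl : linear g by move=> c a b; apply: f_inj; rewrite linearP !fK.
have gM a b : g (amul a b) = amul (g a) (g b).
  by apply: f_inj; rewrite alg_homM !fK.
have [h hg] := alg_hom_of_fun gl gM.
by exists h; split=> a; rewrite hg //; apply: f_inj; rewrite fK.
Qed.

Lemma field_aut_of_fun (k : fieldType) (f : k -> k) :
  {morph f : a b / a + b} -> {morph f : a b / a * b} -> f 1 = 1 ->
  injective f -> (forall b, exists a, f a = b) ->
  exists phi : field_aut k, forall a, (uval phi : {rmorphism k -> k}) a = f a.
Proof.
have mk (h : k -> k) : {morph h : a b / a + b} -> {morph h : a b / a * b} ->
    h 1 = 1 -> {p : {rmorphism k -> k} | forall a, p a = h a}.
  move=> hD hM h1.
  have h0 : h 0 = 0 by apply: (addrI (h 0)); rewrite -hD !addr0.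
  have hB : zmod_morphism h.
    by move=> a b; apply: (addIr (h b)); rewrite -hD !subrK.
  pose hb := GRing.isZmodMorphism.Build k k h hB.
  pose hm := GRing.isMonoidMorphism.Build k k h (conj h1 hM).
  pose p : {rmorphism k -> k} := HB.pack h hb hm.
  by exists p.
move=> fD fM f1 f_inj f_surj; pose g b := sval (cid (f_surj b)).
have fK b : f (g b) = b by exact: svalP (cid (f_surj b)).
have [p pf] := mk f fD fM f1.
have [q qg] : {q : {rmorphism k -> k} | forall a, q a = g a}.
  by apply: mk => [a b|a b|]; apply: f_inj; rewrite ?fD ?fM ?f1 !fK.
have pq : ((p : field_end k) * (q : field_end k))%g = 1%g.
  by apply: field_end_ext => a /=; rewrite pf qg fK.
have qp : ((q : field_end k) * (p : field_end k))%g = 1%g.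
  by apply: field_end_ext => a /=; rewrite pf qg; apply: f_inj; rewrite fK.
by exists (MUnit pq qp).
Qed.

(** * The image of the free algebra on one generator, and the action on elements *)

Section Main.
Variables (k : fieldType) (char0 : [pchar k] =i pred0) (E : set zidentity).
Hypothesis anti : subvariety k E [set anticommutativity].
Hypothesis nontriv : ~ same_variety k E [set triviality].
Hypothesis nonnull : ~ same_variety k E [set null_product].
Local Notation Fr X := (free_alg k E (X : {fset nat})).
Local Notation gen := (@free_gen k E _).
Local Notation Cat := (free_cat k E).

Local Definition one : {fset nat} := [fset 0%N]%fset.
Local Definition two : {fset nat} := [fset 0%N; 1%N]%fset.
Local Definition x0 : one := [` fset11 0%N]%fset.
Local Definition y0 : two := [` fset21 0%N 1%N]%fset.
Local Definition y1 : two := [` fset22 0%N 1%N]%fset.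

Lemma oneP (x : one) : x = x0.
Proof. by apply: val_inj; have /fset1P := valP x. Qed.

Lemma twoP (x : two) : x = y0 \/ x = y1.
Proof.
by have /fset2P[e|e] := valP x; [left|right]; exact: val_inj.
Qed.

Lemma y01 : y1 != y0.
Proof. by []. Qed.

Definition point (X : {fset nat}) (a : Fr X) : @Defs.hom Cat one X :=
  free_eval_hom (@free_alg_variety k E X) (fun _ : one => a).

Lemma point_gen (X : {fset nat}) (a : Fr X) x : point a (gen x) = a.
Proof. exact: (free_eval_gen (@free_alg_variety k E X)). Qed.

Lemma point_comp (X Y : {fset nat}) (f : @Defs.hom Cat X Y) a :
  point (f a) = Defs.comp f (point a).
Proof.
apply: (free_hom_ext (@free_alg_variety k E Y)) => x.
by rewrite point_gen -[RHS]/(f (point a (gen x))) point_gen.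
Qed.

Definition pair_hom (A : linalg k) (EA : variety E A) (a b : A) :
    alg_hom (Fr two) A :=
  free_eval_hom EA (fun x : two => if x == y0 then a else b).

Lemma pair_hom0 (A : linalg k) (EA : variety E A) (a b : A) :
  pair_hom EA a b (gen y0) = a.
Proof. by rewrite free_eval_gen eqxx. Qed.
Lemma pair_hom1 (A : linalg k) (EA : variety E A) (a b : A) :
  pair_hom EA a b (gen y1) = b.
Proof. by rewrite free_eval_gen (negPf y01). Qed.

Lemma two_hom_ext (A : linalg k) (EA : variety E A) (f g : alg_hom (Fr two) A) :
  f (gen y0) = g (gen y0) -> f (gen y1) = g (gen y1) -> f =1 g.
Proof.
move=> f0 f1 a; congr (alg_fun _ a); apply: (free_hom_ext EA) => x.
by case: (twoP x) => ->.
Qed.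

Lemma end_one_comm (f g : @Defs.hom Cat one one) :
  Defs.comp f g = Defs.comp g f.
Proof.
apply: (free_hom_ext (@free_alg_variety k E one)) => x.
rewrite -[LHS]/(f (g (gen x))) -[RHS]/(g (f (gen x))) (oneP x).
have [c ec] := free_one_line char0 anti oneP (f (gen x0)).
have [d ed] := free_one_line char0 anti oneP (g (gen x0)).
by rewrite ec ed !alg_homZ ec ed !scalerA mulrC.
Qed.

Section Automorphism.
Variable U : cat_aut Cat.
Local Notation F := (uval U : endofunctor Cat).
Local Notation F1 := ((F : Cat -> Cat) one : {fset nat}).

Lemma end_F1_comm (f g : @Defs.hom Cat F1 F1) :
  Defs.comp f g = Defs.comp g f.
Proof.
have [f' <-] := cat_aut_full f; have [g' <-] := cat_aut_full g.
by rewrite -!fmap_comp end_one_comm.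
Qed.

(* The endomorphisms of F(one) commute and are not all equal; two generators
   would give the noncommuting endomorphisms "kill x, fix the others" and
   "send everything to y". *)
Lemma F1_singleton : exists x : F1, forall y, y = x.
Proof.
(* With no generators all endomorphisms of the image coincide, so by faithfulness the identity and
   the zero map of [F(x)] would too. *)
have [e0|[n nF1]] := fset_0Vmem F1.
  have hom_eq (f g : @Defs.hom Cat F1 F1) : f = g.
    apply: (free_hom_ext (@free_alg_variety k E F1)) => x.
    by have xF1 : val x \in F1 := valP x; exfalso; move: (val x) xF1; rewrite e0.
  have : idm (one : Cat) = point (0 : Fr one).
    by apply: cat_aut_faithful; exact: hom_eq.
  move=> /(congr1 (fun f : @Defs.hom Cat one one => f (gen x0))).
  by rewrite point_gen => gx0; case: (gen_neq0 nontriv gx0).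
exists [` nF1]%fset; set x := [` nF1]%fset => y.
have [//|yx] := eqVneq y x.
pose f : @Defs.hom Cat F1 F1 := free_eval_hom (@free_alg_variety k E F1)
  (fun z : F1 => if z == x then 0 else gen z).
pose g : @Defs.hom Cat F1 F1 := free_eval_hom (@free_alg_variety k E F1)
  (fun z : F1 => gen y).
have fE z : f (gen z) = if z == x then 0 else gen z.
  exact: (free_eval_gen (@free_alg_variety k E F1)).
have gE z : g (gen z) = gen y.
  exact: (free_eval_gen (@free_alg_variety k E F1)).
have /(congr1 (fun h : @Defs.hom Cat F1 F1 => h (gen x))) := end_F1_comm f g.
rewrite -[X in X = _]/(f (g (gen x))) -[X in _ = X]/(g (f (gen x))).
rewrite gE !fE eqxx (negPf yx) alg_hom0.
by move=> gy0; case: (gen_neq0 nontriv gy0).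
Qed.

Local Definition z0 : F1 := sval (cid F1_singleton).
Lemma F1P (z : F1) : z = z0.
Proof. exact: (svalP (cid F1_singleton)). Qed.

(* On elements, viewed as points, the functor F acts by the bijection smap. *)
Definition smap (X : {fset nat}) (a : Fr X) : Fr (F X) :=
  (fmap F (point a) : @Defs.hom Cat F1 (F X)) (gen z0).

Lemma smap_nat (X Y : {fset nat}) (f : @Defs.hom Cat X Y) a :
  smap (f a) = (fmap F f : @Defs.hom Cat (F X) (F Y)) (smap a).
Proof. by rewrite /smap point_comp fmap_comp. Qed.

(** A morphism out of the image of [one] is determined by its value at the only generator [z0], and
    [F] is faithful. *)
Lemma smap_inj X : injective (@smap X).
Proof.
move=> a b eab.
have ef : fmap F (point a) = fmap F (point b).
  apply: (free_hom_ext (@free_alg_variety k E (F X))) => z.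
  by rewrite (F1P z).
by rewrite -(point_gen a x0) (cat_aut_faithful ef) point_gen.
Qed.

Lemma smap_gen : smap (gen x0) = gen z0.
Proof.
have e : point (gen x0) = idm (one : Cat).
  apply: (free_hom_ext (@free_alg_variety k E one)) => x.
  by rewrite point_gen (oneP x).
by rewrite /smap e fmap_id.
Qed.

Lemma smap_surj (X : {fset nat}) (b : Fr (F X)) : exists a : Fr X, smap a = b.
Proof.
pose h : @Defs.hom Cat F1 (F X) :=
  free_eval_hom (@free_alg_variety k E (F X)) (fun=> b).
have [f ef] := cat_aut_full h.
exists (f (gen x0)); rewrite smap_nat ef smap_gen.
exact: (free_eval_gen (@free_alg_variety k E (F X))).
Qed.

(** * Transport of two-variable words along the automorphism *)

Definition two_hom (X : {fset nat}) (a b : Fr X) : @Defs.hom Cat two X :=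
  pair_hom (@free_alg_variety k E X) a b.

(** By [tmap_bij] this is an isomorphism, so every element of the image of [two] is a word in
    [smap (gen y0)] and [smap (gen y1)]. *)
Definition tmap : @Defs.hom Cat two (F two) :=
  two_hom (smap (gen y0)) (smap (gen y1)).

Lemma fmap_two_hom (X : {fset nat}) (a b : Fr X) w :
  (fmap F (two_hom a b) : @Defs.hom Cat (F two) (F X)) (tmap w) =
  two_hom (smap a) (smap b) w.
Proof.
pose h := Defs.comp (fmap F (two_hom a b)) tmap.
apply: (@two_hom_ext _ (@free_alg_variety k E (F X)) h).
  rewrite -[LHS]/((fmap F (two_hom a b) : @Defs.hom Cat (F two) (F X)) (tmap (gen y0))).
  by rewrite !pair_hom0 -smap_nat pair_hom0.
rewrite -[LHS]/((fmap F (two_hom a b) : @Defs.hom Cat (F two) (F X)) (tmap (gen y1))).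
by rewrite !pair_hom1 -smap_nat pair_hom1.
Qed.

(** Reads [u] and [w] as binary operations: [smap] carries the operation [u] to the operation
    [w]. *)
Lemma smap_word (X : {fset nat}) (a b : Fr X) u w : smap u = tmap w ->
  smap (two_hom a b u) = two_hom (smap a) (smap b) w.
Proof. by move=> e; rewrite smap_nat e fmap_two_hom. Qed.

Lemma smap_coordinates (Y : {fset nat}) (c d : Fr Y) :
  exists g : @Defs.hom Cat (F two) Y,
    g (smap (gen y0)) = c /\ g (smap (gen y1)) = d.
Proof.
(* Every object is an image under [F], which makes [c] and [d] values of [smap]. *)
have [Y' eY] := cat_aut_surj U Y; subst Y.
have [a <-] := smap_surj c; have [b <-] := smap_surj d.
exists (fmap F (two_hom a b)).
by rewrite -!smap_nat pair_hom0 pair_hom1.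
Qed.

Lemma tmap_bij : exists g : @Defs.hom Cat (F two) two,
  cancel tmap g /\ cancel g tmap.
Proof.
have [g [g0 g1]] := @smap_coordinates two (gen y0) (gen y1).
have tK : cancel tmap g.
  apply: (@two_hom_ext _ (@free_alg_variety k E two)
    (Defs.comp g tmap) (idm (two : Cat))).
    by rewrite -[LHS]/(g (tmap (gen y0))) pair_hom0.
  by rewrite -[LHS]/(g (tmap (gen y1))) pair_hom1.
exists g; split=> // b.
(* For the other composite: it is [F h] for some [h], and [h] fixes both generators because [smap]
   is injective. *)
have [h eh] := cat_aut_full (Defs.comp tmap g).
have h1 : h = idm (two : Cat).
  apply: (free_hom_ext (@free_alg_variety k E two)) => x.
  apply: smap_inj; rewrite smap_nat eh.
  by case: (twoP x) => ->;
    rewrite -[LHS]/(tmap (g (smap (gen _)))) ?g0 ?g1 ?pair_hom0 ?pair_hom1.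
by rewrite -[LHS]/((Defs.comp tmap g : @Defs.hom Cat _ _) b) -eh h1 fmap_id.
Qed.

Lemma tmap_inj : injective tmap.
Proof. by have [g [tK _]] := tmap_bij; exact: can_inj tK. Qed.

Lemma tmap_surj b : exists w, tmap w = b.
Proof. by have [g [_ gK]] := tmap_bij; exists (g b); exact: gK. Qed.

(** * The map induced on scalars, and the words for sum and product *)

Lemma scalar_exists c : exists d, smap (c *: gen x0) = d *: gen z0.
Proof. exact: (free_one_line char0 anti F1P). Qed.

Definition scalar c : k := sval (cid (scalar_exists c)).

(** [c *: a] is the image of [c *: gen x0] under [point a], so naturality reduces the claim to one
    generator. *)
Lemma smapZ (X : {fset nat}) c (a : Fr X) : smap (c *: a) = scalar c *: smap a.
Proof.
rewrite -[in LHS](point_gen a x0) -alg_homZ smap_nat.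
by rewrite (svalP (cid (scalar_exists c))) alg_homZ.
Qed.

Lemma smap_x0Z c : smap (c *: gen x0) = scalar c *: gen z0.
Proof. by rewrite smapZ smap_gen. Qed.

Lemma scalar_inj : injective scalar.
Proof.
move=> c d e; apply: (scale_gen_inj nontriv (x := x0)).
by apply: smap_inj; rewrite !smap_x0Z e.
Qed.

Lemma scalar_surj d : exists c, scalar c = d.
Proof.
have [a ea] := smap_surj (d *: gen z0).
have [c ac] := free_one_line char0 anti oneP a.
exists c; apply: (scale_gen_inj nontriv (x := z0)).
by rewrite -smap_x0Z -ac.
Qed.

Lemma scalarM : {morph scalar : c d / c * d}.
Proof.
move=> c d; apply: (scale_gen_inj nontriv (x := z0)).
by rewrite -smap_x0Z -scalerA !smapZ smap_gen scalerA.
Qed.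

Lemma scalar1 : scalar 1 = 1.
Proof.
apply: (scale_gen_inj nontriv (x := z0)).
by rewrite -smap_x0Z !scale1r smap_gen.
Qed.

Lemma smap0 (X : {fset nat}) : smap (0 : Fr X) = 0.
Proof.
have [c c0] := scalar_surj 0.
by rewrite -(scaler0 _ c) smapZ c0 scale0r.
Qed.

Lemma two_hom_scale (X : {fset nat}) c (a b : Fr X) w :
  two_hom (c *: a) (c *: b) w = two_hom a b (two_hom (c *: gen y0) (c *: gen y1) w).
Proof.
apply: (@two_hom_ext _ (@free_alg_variety k E X) (two_hom (c *: a) (c *: b))
  (Defs.comp (two_hom a b) (two_hom (c *: gen y0) (c *: gen y1)))).
  rewrite -[RHS]/(two_hom a b (two_hom (c *: gen y0) (c *: gen y1) (gen y0))).
  by rewrite !pair_hom0 alg_homZ pair_hom0.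
rewrite -[RHS]/(two_hom a b (two_hom (c *: gen y0) (c *: gen y1) (gen y1))).
by rewrite !pair_hom1 alg_homZ pair_hom1.
Qed.

(* A word in two variables which is homogeneous of degree n goes to one with
   the same property, seen by rescaling the variables by the scalar that F
   turns into 2. *)
Lemma word_graded n c u w : scalar c = 2%:R ->
  two_hom (c *: gen y0) (c *: gen y1) u = c ^+ n *: u -> smap u = tmap w ->
  graded y0 y1 n w.
Proof.
move=> c2 u_hom uw; apply: (eigen_graded char0 anti twoP); apply: tmap_inj.
have scalarX : scalar (c ^+ n) = 2%:R ^+ n.
  by elim: n {u_hom} => [|n IH]; rewrite ?expr0 ?scalar1 // !exprS scalarM IH c2.
(* One side becomes [2 ^ n] times [tmap w], the other [tmap] of the rescaled word. *)
have := smap_word (c *: gen y0) (c *: gen y1) uw.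
rewrite u_hom smapZ scalarX uw !smapZ c2 two_hom_scale => e.
rewrite alg_homZ e; congr (tmap _).
apply: (two_hom_ext (@free_alg_variety k E two)).
  by rewrite double_gen pair_hom0.
by rewrite double_gen pair_hom1.
Qed.

Lemma gen_y_neq0 (y : two) : smap (gen y) != 0.
Proof.
apply/eqP; rewrite -(smap0 two) => /smap_inj; exact: (gen_neq0 nontriv).
Qed.

Lemma smapD (X : {fset nat}) (a b : Fr X) : smap (a + b) = smap a + smap b.
Proof.
have [t t2] := scalar_surj 2%:R.
have [w /esym ew] := tmap_surj (smap (gen y0 + gen y1)).
have [|c [d ecd]] := word_graded (n := 1) t2 _ ew.
  by rewrite alg_homD pair_hom0 pair_hom1 expr1 scalerDr.
have lin (Y : {fset nat}) (u v : Fr Y) : smap (u + v) = c *: smap u + d *: smap v.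
  have := smap_word u v ew.
  by rewrite ecd !alg_homD !alg_homZ !pair_hom0 !pair_hom1.
(* Setting one argument to 0 isolates each coefficient. *)
have c1 : c = 1.
  have := lin two (gen y0) 0; rewrite smap0 scaler0 !addr0 => /eqP.
  rewrite -[X in X == _]scale1r -subr_eq0 -scalerBl scaler_eq0.
  by rewrite (negPf (gen_y_neq0 _)) orbF subr_eq0 => /eqP.
have d1 : d = 1.
  have := lin two 0 (gen y0); rewrite smap0 scaler0 !add0r => /eqP.
  rewrite -[X in X == _]scale1r -subr_eq0 -scalerBl scaler_eq0.
  by rewrite (negPf (gen_y_neq0 _)) orbF subr_eq0 => /eqP.
by rewrite lin c1 d1 !scale1r.
Qed.

(** Degree 2 leaves only multiples of [amul (gen y0) (gen y1)]. The coefficient is nonzero since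
    otherwise the injective [smap] would kill this nonzero product. *)
Lemma smapM : exists g, g != 0 /\ forall (X : {fset nat}) (a b : Fr X),
  smap (amul a b) = g *: amul (smap a) (smap b).
Proof.
have [t t2] := scalar_surj 2%:R.
have [w /esym ew] := tmap_surj (smap (amul (gen y0) (gen y1))).
have [|g eg] := word_graded (n := 2) t2 _ ew.
  by rewrite alg_homM pair_hom0 pair_hom1 amulZl amulZr scalerA expr2.
have mul (Y : {fset nat}) (u v : Fr Y) :
    smap (amul u v) = g *: amul (smap u) (smap v).
  have := smap_word u v ew.
  by rewrite eg alg_homZ !alg_homM !pair_hom0 !pair_hom1.
exists g; split=> //; apply/eqP => g0.
have := mul two (gen y0) (gen y1); rewrite g0 scale0r -(smap0 two) => /smap_inj.
by apply: (amul_gen_neq0 char0 anti nontriv nonnull); rewrite eq_sym; exact: y01.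
Qed.

Lemma scalarD : {morph scalar : c d / c + d}.
Proof.
move=> c d; apply: (scale_gen_inj nontriv (x := z0)).
by rewrite scalerDl -!smap_x0Z scalerDl smapD.
Qed.

(* After the rescaling by g, the bijection smap is multiplicative and
   semilinear; dividing by the semilinear map of the same field automorphism
   that fixes the generators leaves an isomorphism of algebras. *)
Lemma isofun_conj : exists phi : field_aut k,
  isomorphic_functors (conj_functor E phi) F.
Proof.
have [phi phiE] := field_aut_of_fun scalarD scalarM scalar1 scalar_inj scalar_surj.
exists phi; have [g [g0 smapMg]] := smapM.
pose um := uinv phi : {rmorphism k -> k}.
pose up := uval phi : {rmorphism k -> k}.
pose rmap (X : {fset nat}) (a : Fr X) : Fr (F X) := g *: smap (semilin um a).
have rlin X : linear (@rmap X).
  move=> c a b; rewrite /rmap semilinD semilinZ smapD smapZ -phiE field_autVK.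
  by rewrite scalerDr !scalerA mulrC.
have rmul X (a b : Fr X) : rmap X (amul a b) = amul (rmap X a) (rmap X b).
  by rewrite /rmap semilinM smapMg amulZl amulZr.
pose r X := sval (alg_hom_of_fun (rlin X) (rmul X)).
have rE X a : r X a = rmap X a by exact: (svalP (alg_hom_of_fun (rlin X) (rmul X))).
exists r; split=> [X|X Y f].
  have [||q [qK rK]] := @alg_hom_inverse _ _ _ (r X).
  - move=> a b; rewrite !rE => /(scalerI g0) /smap_inj.
    exact: (can_inj (semilinVK phi (X := X))).
  (* Undo the factor [g] first, then the semilinear map. *)
  - move=> b; have [a ea] := smap_surj (g^-1 *: b); exists (semilin up a).
    by rewrite rE /rmap semilinKV ea scalerA divff // scale1r.
  exists q; split; apply: alg_hom_ext => a; [exact: qK | exact: rK].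
apply: alg_hom_ext => a.
rewrite -[LHS]/((fmap F f : @Defs.hom Cat (F X) (F Y)) (r X a)).
rewrite -[RHS]/(r Y (conj_hom phi f a)) !rE /rmap alg_homZ -smap_nat.
by rewrite -[conj_hom phi f a]/(semilin up (f (semilin um a))) semilinKV.
Qed.

End Automorphism.

(** * Inner conjugations and the quotient group *)

Lemma inner_conj_aut (phi : field_aut k) : is_inner (conj_aut E phi) -> phi = 1%g.
Proof.
case=> s [iso_s nat_s]; apply: munit_inj; apply: field_end_ext => c.
pose s1 : @Defs.hom Cat one one := s one.
have [d ed] := free_one_line char0 anti oneP (s1 (gen x0)).
have d0 : d != 0.
  apply/eqP => d0; have [t [ts _]] := iso_s one.
  have := congr1 (fun f : @Defs.hom Cat one one => f (gen x0)) ts.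
  rewrite -[X in X = _]/((t : @Defs.hom Cat one one) (s1 (gen x0))) ed d0.
  by rewrite scale0r alg_hom0 => /esym gx0; case: (gen_neq0 nontriv gx0).
have := congr1 (fun f : @Defs.hom Cat one one => f (gen x0))
  (nat_s one one (point (c *: gen x0))).
rewrite -[X in X = _]/(conj_hom phi (point (c *: gen x0)) (s1 (gen x0))).
rewrite -[X in _ = X]/(s1 (point (c *: gen x0) (gen x0))).
rewrite point_gen ed !alg_homZ ed.
(* The generator is rewritten as its own semilinear image so that [conj_hom_semilin] applies;
   naturality then says that [phi c] and [c] agree after multiplication by [d]. *)
rewrite -[in X in X = _](semilin_gen E (uval phi : field_end k) x0).
rewrite conj_hom_semilin point_gen semilinZ !semilin_gen !scalerA.
by move=> e; have := scale_gen_inj nontriv e; rewrite mulrC => /(mulIf d0).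
Qed.

End Main.

Theorem theorem4p5 (k : fieldType) (char0 : [pchar k]%R =i pred0)
    (E : set zidentity) :
  subvariety k E [set anticommutativity] ->
  ~ same_variety k E [set triviality] ->
  ~ same_variety k E [set null_product] ->
  isomorphic_groups (quotg (inner_auts (free_cat k E))) (field_aut k).
Proof.
move=> anti nontriv nonnull.
pose N := inner_auts (free_cat k E).
(* The natural map starts from the field automorphisms; the isomorphism is stated in the other
   direction, so the inverse of [h] is bundled at the end. *)
pose h phi : quotg N := quotg_pi N (conj_aut E phi).
have hM phi psi : h (phi * psi)%g = (h phi * h psi)%g.
  rewrite /h conj_autM; exact/esym/(quotg_piM N).
have h_inj : injective h.
  move=> phi psi e; have /quotg_eqP := e; rewrite /coset_rel => {e}.
  have -> : (conj_aut E phi)^-1%g = conj_aut E phi^-1%g by exact: munit_inj.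
  rewrite -conj_autM => /asboolP /(inner_conj_aut char0 anti nontriv) e.
  by rewrite -[psi]mul1g -(mulgV phi) -mulgA e mulg1.
have h_surj q : exists phi, h phi = q.
  rewrite -(quotg_piK q).
  have [phi isophi] := isofun_conj char0 anti nontriv nonnull (repr q).
  by exists phi; apply/quotg_eqP; exact: coset_rel_isofun.
pose g q := sval (cid (h_surj q)).
have gK : cancel g h by move=> q; exact: (svalP (cid (h_surj q))).
have hK : cancel h g by move=> phi; apply: h_inj; rewrite gK.
have gM : {morph g : p q / (p * q)%g} by move=> p q; apply: h_inj; rewrite hM !gK.
pose gm := isMultiplicative.Build _ _ g gM.
pose gG : {multiplicative quotg N -> field_aut k} := HB.pack g gm.
by exists gG; exists h.
Qed.
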